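(* Let $G\mathcal{L}$ be the Gentzen relation axiomatized by the calculus $G\mathcal{B}$ extended by a set of generalized cut rules. Then $G\mathcal{L}$ enjoys $(G\mathcal{L},G\mathcal{B})$-interpolation: whenever a sequent $t$ is derivable from a sequent $s$ in $G\mathcal{L}$, there is a sequent $u$ such that $u$ is derivable from $s$ in $G\mathcal{L}$, $t$ is derivable from $u$ in $G\mathcal{B}$, and every atom occurring in $u$ occurs in both $s$ and $t$.
   Context: Formulas are built from atoms using $\wedge,\vee,{-},\top,\bot$; a sequent $\Gamma\vartriangleright\Delta$ is a pair of finite multisets of formulas; atomic if all its formulas are atoms. The calculus $G\mathcal{B}$ consists of: introduction rules (from $\Gamma\vartriangleright\Delta,\varphi$ and $\Gamma\vartriangleright\Delta,\psi$ infer $\Gamma\vartriangleright\Delta,\varphi\wedge\psi$; from $\varphi,\psi,\Gamma\vartriangleright\Delta$ infer $\varphi\wedge\psi,\Gamma\vartriangleright\Delta$; from $\varphi,\Gamma\vartriangleright\Delta$ and $\psi,\Gamma\vartriangleright\Delta$ infer $\varphi\vee\psi,\Gamma\vartriangleright\Delta$; from $\Gamma\vartriangleright\Delta,\varphi,\psi$ infer $\Gamma\vartriangleright\Delta,\varphi\vee\psi$; from $\varphi,\Gamma\vartriangleright\Delta$ infer $\Gamma\vartriangleright\Delta,{-}\varphi$; from $\Gamma\vartriangleright\Delta,\varphi$ infer ${-}\varphi,\Gamma\vartriangleright\Delta$; axioms $\emptyset\vartriangleright\top$, $\bot\vartriangleright\emptyset$); elimination rules (from $\Gamma\vartriangleright\Delta,\varphi\wedge\psi$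 infer $\Gamma\vartriangleright\Delta,\varphi$, and infer $\Gamma\vartriangleright\Delta,\psi$; from $\varphi\wedge\psi,\Gamma\vartriangleright\Delta$ infer $\varphi,\psi,\Gamma\vartriangleright\Delta$; from $\varphi\vee\psi,\Gamma\vartriangleright\Delta$ infer $\varphi,\Gamma\vartriangleright\Delta$, and infer $\psi,\Gamma\vartriangleright\Delta$; from $\Gamma\vartriangleright\Delta,\varphi\vee\psi$ infer $\Gamma\vartriangleright\Delta,\varphi,\psi$; from $\Gamma\vartriangleright\Delta,{-}\varphi$ infer $\varphi,\Gamma\vartriangleright\Delta$; from ${-}\varphi,\Gamma\vartriangleright\Delta$ infer $\Gamma\vartriangleright\Delta,\varphi$; from $\top,\Gamma\vartriangleright\Delta$ infer $\Gamma\vartriangleright\Delta$; from $\Gamma\vartriangleright\Delta,\bot$ infer $\Gamma\vartriangleright\Delta$); Weakening and Contraction on both sides. $G\mathcal{B}$ also denotes the derivability relation of this calculus. A structural rule is a rule (possibly infinitary) whose premises and conclusion are atomic sequents, applied in all substitution instances. An atom is a cut formula of a structural rule if it occurs only in the premises of the rule; it is a side formula if it occurs only on left-hand sides, or only on right-hand sides, of the sequents of the rule. A generalized cut rule is a structural rule in which every atom occurring in it is a cut formula or a side formula. The Gentzen relation axiomatized by a calculus is the relation ''$t$ is derivable from the set $S$ in the calculus'' (proofs being well-founded labelled trees). *)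

(* Defs.v *)
From HB Require Import structures.
From mathcomp Require Import all_boot.
From mathcomp Require Import finmap multiset classical_sets.

Set Implicit Arguments.
Unset Strict Implicit.
Unset Printing Implicit Defensive.

Local Open Scope mset_scope.
Local Open Scope classical_set_scope.

Inductive formula (A : Type) : Type :=
  | Atom of A
  | Top
  | Bot
  | Neg of formula A
  | And of formula A & formula A
  | Or of formula A & formula A.

Arguments Top {A}.
Arguments Bot {A}.

(* Multisets require a choiceType of elements. *)
Section FormulaChoice.
Variable A : Type.

Fixpoint formula_encode (f : formula A) : GenTree.tree A :=
  match f with
  | Atom p => GenTree.Leaf p
  | Top => GenTree.Node 0 [::]
  | Bot => GenTree.Node 1 [::]
  | Neg g => GenTree.Node 2 [:: formula_encode g]
  | And g h => GenTree.Node 3 [:: formula_encode g; formula_encode h]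
  | Or g h => GenTree.Node 4 [:: formula_encode g; formula_encode h]
  end.

Fixpoint formula_decode (t : GenTree.tree A) : formula A :=
  match t with
  | GenTree.Leaf p => Atom p
  | GenTree.Node 0 _ => Top
  | GenTree.Node 2 [:: g] => Neg (formula_decode g)
  | GenTree.Node 3 [:: g; h] => And (formula_decode g) (formula_decode h)
  | GenTree.Node 4 [:: g; h] => Or (formula_decode g) (formula_decode h)
  | GenTree.Node _ _ => Bot
  end.

Lemma formula_encodeK : cancel formula_encode formula_decode.
Proof. by elim=> //= [g ->|g -> h ->|g -> h ->]. Qed.

End FormulaChoice.

HB.instance Definition _ (A : choiceType) :=
  Choice.copy (formula A) (can_type (@formula_encodeK A)).

Record sequent (A : choiceType) := Sequent {
  lhs : {mset formula A};
  rhs : {mset formula A}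
}.

Notation "G ===> D" := (Sequent G%mset D%mset) (at level 75, no associativity).

Section Syntax.
Variable A : choiceType.
Implicit Types (p : A) (f g : formula A) (s : sequent A).

Fixpoint atoms f : seq A :=
  match f with
  | Atom p => [:: p]
  | Top | Bot => [::]
  | Neg g => atoms g
  | And g h | Or g h => atoms g ++ atoms h
  end.

Definition occurs_in p (G : {mset formula A}) : Prop :=
  exists2 f, f \in G & p \in atoms f.

Definition occurs p s : Prop := occurs_in p (lhs s) \/ occurs_in p (rhs s).

Definition atomic_mset (G : {mset formula A}) : Prop :=
  forall f, f \in G -> exists p, f = Atom p.

Definition atomic s : Prop := atomic_mset (lhs s) /\ atomic_mset (rhs s).

Fixpoint subst (sigma : A -> formula A) f : formula A :=
  match f with
  | Atom p => sigma p
  | Top => Top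
  | Bot => Bot
  | Neg g => Neg (subst sigma g)
  | And g h => And (subst sigma g) (subst sigma h)
  | Or g h => Or (subst sigma g) (subst sigma h)
  end.

(* The image of a multiset, multiplicities being added up. *)
Definition subst_mset (sigma : A -> formula A) (G : {mset formula A}) :
    {mset formula A} :=
  seq_mset (map (subst sigma) G).

Definition subst_sequent (sigma : A -> formula A) s : sequent A :=
  subst_mset sigma (lhs s) ===> subst_mset sigma (rhs s).

End Syntax.

(* The set of premises may be infinite. *)
Record rule (A : choiceType) := Rule {
  premises : set (sequent A);
  conclusion : sequent A
}.

Section Rules.
Variable A : choiceType.
Implicit Types (r : rule A) (p : A).

Definition structural r : Prop :=
  (forall s, premises r s -> atomic s) /\ atomic (conclusion r).

Definition in_rule r (s : sequent A) : Prop :=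
  premises r s \/ s = conclusion r.

Definition occurs_in_rule r p : Prop := exists2 s, in_rule r s & occurs p s.

Definition cut_formula r p : Prop :=
  (exists2 s, premises r s & occurs p s) /\ ~ occurs p (conclusion r).

Definition side_formula r p : Prop :=
  occurs_in_rule r p /\
  ((forall s, in_rule r s -> ~ occurs_in p (rhs s)) \/
   (forall s, in_rule r s -> ~ occurs_in p (lhs s))).

Definition generalized_cut r : Prop :=
  structural r /\
  forall p, occurs_in_rule r p -> cut_formula r p \/ side_formula r p.

End Rules.

Definition gentzen_relation (A : choiceType) :=
  set (sequent A) -> sequent A -> Prop.

(* [derivable R S t]: there is a well-founded proof of t from S in the calculus
   GB extended by all substitution instances of the rules in R. *)
Inductive derivable (A : choiceType) (R : set (rule A)) (S : set (sequent A)) :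
    sequent A -> Prop :=
  | d_hyp t : S t -> derivable R S t
  | d_rule (r : rule A) (sigma : A -> formula A) :
      R r ->
      (forall s, premises r s -> derivable R S (subst_sequent sigma s)) ->
      derivable R S (subst_sequent sigma (conclusion r))
  | d_andIr (G D : {mset formula A}) (f g : formula A) :
      derivable R S (G ===> f +` D) -> derivable R S (G ===> g +` D) ->
      derivable R S (G ===> And f g +` D)
  | d_andIl (G D : {mset formula A}) (f g : formula A) :
      derivable R S (f +` (g +` G) ===> D) ->
      derivable R S (And f g +` G ===> D)
  | d_orIl (G D : {mset formula A}) (f g : formula A) :
      derivable R S (f +` G ===> D) -> derivable R S (g +` G ===> D) ->
      derivable R S (Or f g +` G ===> D)
  | d_orIr (G D : {mset formula A}) (f g : formula A) :
      derivable R S (G ===> f +` (g +` D)) ->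
      derivable R S (G ===> Or f g +` D)
  | d_negIr (G D : {mset formula A}) (f : formula A) :
      derivable R S (f +` G ===> D) -> derivable R S (G ===> Neg f +` D)
  | d_negIl (G D : {mset formula A}) (f : formula A) :
      derivable R S (G ===> f +` D) -> derivable R S (Neg f +` G ===> D)
  | d_topI : derivable R S (mset0 ===> [mset Top])
  | d_botI : derivable R S ([mset Bot] ===> mset0)
  | d_andEr1 (G D : {mset formula A}) (f g : formula A) :
      derivable R S (G ===> And f g +` D) -> derivable R S (G ===> f +` D)
  | d_andEr2 (G D : {mset formula A}) (f g : formula A) :
      derivable R S (G ===> And f g +` D) -> derivable R S (G ===> g +` D)
  | d_andEl (G D : {mset formula A}) (f g : formula A) :
      derivable R S (And f g +` G ===> D) ->
      derivable R S (f +` (g +` G) ===> D)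
  | d_orEl1 (G D : {mset formula A}) (f g : formula A) :
      derivable R S (Or f g +` G ===> D) -> derivable R S (f +` G ===> D)
  | d_orEl2 (G D : {mset formula A}) (f g : formula A) :
      derivable R S (Or f g +` G ===> D) -> derivable R S (g +` G ===> D)
  | d_orEr (G D : {mset formula A}) (f g : formula A) :
      derivable R S (G ===> Or f g +` D) ->
      derivable R S (G ===> f +` (g +` D))
  | d_negEr (G D : {mset formula A}) (f : formula A) :
      derivable R S (G ===> Neg f +` D) -> derivable R S (f +` G ===> D)
  | d_negEl (G D : {mset formula A}) (f : formula A) :
      derivable R S (Neg f +` G ===> D) -> derivable R S (G ===> f +` D)
  | d_topE (G D : {mset formula A}) :
      derivable R S (Top +` G ===> D) -> derivable R S (G ===> D)
  | d_botE (G D : {mset formula A}) :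
      derivable R S (G ===> Bot +` D) -> derivable R S (G ===> D)
  | d_weakl (G D : {mset formula A}) (f : formula A) :
      derivable R S (G ===> D) -> derivable R S (f +` G ===> D)
  | d_weakr (G D : {mset formula A}) (f : formula A) :
      derivable R S (G ===> D) -> derivable R S (G ===> f +` D)
  | d_contrl (G D : {mset formula A}) (f : formula A) :
      derivable R S (f +` (f +` G) ===> D) -> derivable R S (f +` G ===> D)
  | d_contrr (G D : {mset formula A}) (f : formula A) :
      derivable R S (G ===> f +` (f +` D)) -> derivable R S (G ===> f +` D).

Definition GB_with (A : choiceType) (R : set (rule A)) : gentzen_relation A :=
  derivable R.

Definition GB (A : choiceType) : gentzen_relation A := GB_with set0.

Definition has_interpolation (A : choiceType) (L L1 L2 : gentzen_relation A) :
    Prop :=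
  forall s t : sequent A, L [set s] t ->
  exists u : sequent A,
    [/\ L1 [set s] u, L2 [set u] t &
        forall p : A, occurs p u -> occurs p s /\ occurs p t].

(* Main.v *)
Require Import Defs.
From mathcomp Require Import all_boot finmap multiset boolp classical_sets.

Set Implicit Arguments.
Unset Strict Implicit.
Unset Printing Implicit Defensive.

Local Open Scope mset_scope.

(** Suppose that [t] is derivable from [s]. In every sequent, forget each atom
    that does not occur in [s]: replace it by [Top] at the occurrences that are
    positive on the left or negative on the right, and by [Bot] at the others; on
    clauses this deletes the forgotten literals. This fixes [s] and commutes with
    the rules of GB. In an instance of a generalized cut rule, the formula put for
    a side formula is only ever transformed in one of the two ways, whereas the
    formula put for a cut formula splits into two formulas, the right one entailing
    the left one, so that either may be cut instead. Hence the transform of [t]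
    is derivable from [s]. It entails [t] in GB by monotonicity, and only
    contains atoms common to [s] and [t]. *)

(** * Images of finite multisets *)

Lemma seq_mset_nil (K : choiceType) : seq_mset [::] = mset0 :> {mset K}.
Proof. by apply/msetP => x; rewrite mset_seqE mset0E. Qed.

Section MultisetImage.
Variables K L : choiceType.
Implicit Types (F : K -> L) (G : {mset K}).

Definition map_mset F G : {mset L} := seq_mset (map F G).

Lemma map_mset_seq F (l : seq K) : map_mset F (seq_mset l) = seq_mset (map F l).
Proof. exact/eq_seq_msetP/perm_map/perm_eq_seq_mset. Qed.

Lemma map_mset0 F : map_mset F mset0 = mset0.
Proof. by rewrite /map_mset enum_mset0 seq_mset_nil. Qed.

Lemma map_msetD1 F x G : map_mset F (x +` G) = F x +` map_mset F G.
Proof. by rewrite -{1}(seq_mset_id G) -mset_cons map_mset_seq /= mset_cons. Qed.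

Lemma map_mset1 F x : map_mset F [mset x] = [mset F x].
Proof. by rewrite -(msetD0 [mset x]) map_msetD1 map_mset0 msetD0. Qed.

Lemma eq_in_map_mset F F' G :
  {in G, F =1 F'} -> map_mset F G = map_mset F' G.
Proof. by move=> /eq_in_map eqF; rewrite /map_mset eqF. Qed.

Lemma in_map_mset F G y : y \in map_mset F G -> exists2 x, x \in G & y = F x.
Proof. by rewrite (perm_mem (perm_eq_seq_mset _)) => /mapP. Qed.

End MultisetImage.

(** * Entailment between formulas and monotonicity of sequents *)

Section Entailment.
Variables (A : choiceType) (R : set (rule A)) (S : set (sequent A)).
Implicit Types (f g : formula A) (G D : {mset formula A}).
Local Notation der := (derivable R S).

(** Entailment is phrased as replacement on either side: without a cut rule, a derivation of
    [f ===> g] could not be used to replace one formula by the other. *)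
Definition entails f g : Prop :=
  (forall G D, der (G ===> f +` D) -> der (G ===> g +` D)) /\
  (forall G D, der (g +` G ===> D) -> der (f +` G ===> D)).

Lemma entails_refl f : entails f f.
Proof. by []. Qed.

Lemma entails_trans f g h : entails f g -> entails g h -> entails f h.
Proof. by move=> [r1 l1] [r2 l2]; split=> G D H; [apply/r2/r1|apply/l1/l2]. Qed.

Lemma weaken_mset G D G' D' : der (G ===> D) -> der (G' `+` G ===> D' `+` D).
Proof.
move=> dGD.
have {dGD} : der (G' `+` G ===> D).
  rewrite -(seq_mset_id G'); elim: (enum_mset G') => [|f l IH].
    by rewrite seq_mset_nil msetDC msetD0.
  by rewrite mset_cons -msetDA; exact: d_weakl.
move: (G' `+` G) => {G G'}G dGD.
rewrite -(seq_mset_id D'); elim: (enum_mset D') => [|f l IH].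
  by rewrite seq_mset_nil msetDC msetD0.
by rewrite mset_cons -msetDA; exact: d_weakr.
Qed.

Lemma entails_top f : entails f Top.
Proof.
split=> G D H; last exact/d_weakl/d_topE.
rewrite msetDC -(msetD0 G); exact/weaken_mset/d_topI.
Qed.

Lemma entails_bot f : entails Bot f.
Proof.
split=> G D H; first exact/d_weakr/d_botE.
rewrite msetDC -(msetD0 D); exact/weaken_mset/d_botI.
Qed.

(** An elimination rule exposes the subformula on the opposite side, where it is replaced, and an
    introduction rule restores the connective. *)
Lemma entails_neg f g : entails f g -> entails (Neg g) (Neg f).
Proof.
move=> [r l]; split=> G D H; first exact/d_negIr/l/d_negEr.
exact/d_negIl/r/d_negEl.
Qed.

Lemma entails_and f f' g g' :
  entails f f' -> entails g g' -> entails (And f g) (And f' g').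
Proof.
move=> [r l] [r' l']; split=> G D H.
  by apply: d_andIr; [apply/r/d_andEr1/H|apply/r'/d_andEr2/H].
by apply/d_andIl/l; rewrite msetDCA; apply/l'; rewrite msetDCA; apply/d_andEl.
Qed.

Lemma entails_or f f' g g' :
  entails f f' -> entails g g' -> entails (Or f g) (Or f' g').
Proof.
move=> [r l] [r' l']; split=> G D H.
  by apply/d_orIr/r; rewrite msetDCA; apply/r'; rewrite msetDCA; apply/d_orEr.
by apply: d_orIl; [apply/l/d_orEl1/H|apply/l'/d_orEl2/H].
Qed.

Section Map.
Variables (K : choiceType) (F F' : K -> formula A) (M : {mset K}).
Hypothesis FF' : {in M, forall x, entails (F x) (F' x)}.

Lemma derivable_map_msetr G D :
  der (G ===> map_mset F M `+` D) -> der (G ===> map_mset F' M `+` D).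
Proof.
have: {in enum_mset M, forall x, entails (F x) (F' x)} by [].
rewrite /map_mset; elim: (enum_mset M) D => [//|x l IH] D /= Fl; rewrite !mset_cons -!msetDA.
(* Once replaced, the head formula moves into the context, over which the induction is general. *)
move/(proj1 (Fl _ (mem_head _ _))); rewrite !(msetDCA [mset _]); apply: IH.
by move=> y yl; apply: Fl; rewrite inE yl orbT.
Qed.

Lemma derivable_map_msetl G D :
  der (map_mset F' M `+` G ===> D) -> der (map_mset F M `+` G ===> D).
Proof.
have: {in enum_mset M, forall x, entails (F x) (F' x)} by [].
rewrite /map_mset; elim: (enum_mset M) G => [//|x l IH] G /= Fl; rewrite !mset_cons -!msetDA.
move/(proj2 (Fl _ (mem_head _ _))); rewrite !(msetDCA [mset _]); apply: IH.
by move=> y yl; apply: Fl; rewrite inE yl orbT.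
Qed.

End Map.

End Entailment.

(** * Forgetting atoms according to polarity *)

Section Forget.
Variables (A : choiceType) (keep : pred A).
Implicit Types (f g : formula A) (G D : {mset formula A}) (t : sequent A).

(* The flag is the polarity: [forget true] weakens a formula, [forget false]
   strengthens it. *)
Fixpoint forget (b : bool) f : formula A :=
  match f with
  | Atom p => if keep p then Atom p else if b then Top else Bot
  | Top => Top
  | Bot => Bot
  | Neg g => Neg (forget (~~ b) g)
  | And g h => And (forget b g) (forget b h)
  | Or g h => Or (forget b g) (forget b h)
  end.

Definition forget_sequent t : sequent A :=
  map_mset (forget true) (lhs t) ===> map_mset (forget false) (rhs t).

(** Both halves go through one induction because negation exchanges them. *)
Lemma forget_entails (R : set (rule A)) (S : set (sequent A)) f :
  entails R S (forget false f) f /\ entails R S f (forget true f).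
Proof.
elim: f => [p|||f [IH1 IH2]|f [IH1 IH2] g [IH3 IH4]|f [IH1 IH2] g [IH3 IH4]] /=.
- by case: ifP => _; split;
    [exact: entails_refl|exact: entails_refl|exact: entails_bot|exact: entails_top].
- by split; exact: entails_refl.
- by split; exact: entails_refl.
- by split; exact: entails_neg.
- by split; exact: entails_and.
- by split; exact: entails_or.
Qed.

(** Left formulas were weakened and right ones strengthened, so restoring them is a legitimate
    replacement on each side. *)
Lemma derivable_of_forget (R : set (rule A)) (S : set (sequent A)) t :
  derivable R S (forget_sequent t) -> derivable R S t.
Proof.
case: t => G D; rewrite /forget_sequent /= => H.
have idM (M : {mset formula A}) : M = map_mset id M.
  by rewrite /map_mset map_id seq_mset_id.
rewrite (idM G) (idM D) -[map_mset id G]msetD0 -[map_mset id D]msetD0.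
apply: (derivable_map_msetl (F' := forget true)) => [f _|].
  exact: (forget_entails R S f).2.
apply: (derivable_map_msetr (F := forget false)) => [f _|].
  exact: (forget_entails R S f).1.
by rewrite !msetD0.
Qed.

Lemma forget_id b f : {subset atoms f <= keep} -> forget b f = f.
Proof.
elim: f b => //= [p|f IH|f IHf g IHg|f IHf g IHg] b kf.
- by have /= := kf p; rewrite inE eqxx => /(_ isT); rewrite unfold_in => ->.
- by rewrite IH.
- by rewrite IHf ?IHg // => p pf; apply: kf; rewrite mem_cat pf ?orbT.
- by rewrite IHf ?IHg // => p pf; apply: kf; rewrite mem_cat pf ?orbT.
Qed.

Lemma atoms_forget b f p : p \in atoms (forget b f) -> keep p /\ p \in atoms f.
Proof.
elim: f b => //= [q|f IH|f IHf g IHg|f IHf g IHg] b.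
- case: ifP => kq; last by case: b.
  by rewrite /= mem_seq1 => /eqP ->.
- exact: IH.
- by rewrite !mem_cat => /orP[/IHf|/IHg] [-> ->]; rewrite ?orbT.
- by rewrite !mem_cat => /orP[/IHf|/IHg] [-> ->]; rewrite ?orbT.
Qed.

Lemma occurs_in_map_forget b G p :
  occurs_in p (map_mset (forget b) G) -> keep p /\ occurs_in p G.
Proof.
move=> [f /in_map_mset[g gG ->] /atoms_forget[kp pg]]; split=> //.
by exists g.
Qed.

Lemma occurs_forget_sequent t p :
  occurs p (forget_sequent t) -> keep p /\ occurs p t.
Proof.
by move=> [] /occurs_in_map_forget[kp pt]; split=> //; [left|right].
Qed.

Lemma forget_sequent_id t :
  (forall p, occurs p t -> keep p) -> forget_sequent t = t.
Proof.
case: t => G D kt; rewrite /forget_sequent /=.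
have idM b (M : {mset formula A}) :
    (forall p, occurs_in p M -> keep p) -> map_mset (forget b) M = M.
  move=> kM; rewrite -[RHS]seq_mset_id -[in RHS](map_id M).
  apply: eq_in_map_mset => f fM; apply: forget_id => p pf.
  by apply: kM; exists f.
by rewrite !idM // => p pM; apply: kt; [right|left].
Qed.

Lemma occurs_in_atom p G : Atom p \in G -> occurs_in p G.
Proof. by move=> pG; exists (Atom p); rewrite ?inE. Qed.

(** On an atom a substitution is mere evaluation, so forgetting can be absorbed into it. *)
Lemma map_forget_subst b (sigma sigma' : A -> formula A) G :
  atomic_mset G ->
  (forall p, occurs_in p G -> forget b (sigma p) = sigma' p) ->
  map_mset (forget b) (subst_mset sigma G) = subst_mset sigma' G.
Proof.
move=> atG eqs; rewrite /subst_mset map_mset_seq -map_comp.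
apply: eq_in_map_mset => f fG /=; have [p fp] := atG f fG.
by rewrite fp in fG *; apply/eqs/occurs_in_atom.
Qed.

(** * Instances of generalized cut rules *)

Section GeneralizedCut.
Variables (R : set (rule A)) (S : set (sequent A)) (r : rule A).
Variable sigma : A -> formula A.
Hypothesis cut_r : generalized_cut r.

(* Cut formulas may occur on both sides of the premises, and are treated
   like the side formulas of the left. *)
Let right_only p : Prop := forall s, in_rule r s -> ~ occurs_in p (lhs s).

(** One polarity is fixed per atom for the whole rule, so that the transformed instance is again an
    instance of [r]. *)
Definition forget_subst p : formula A :=
  forget (~~ `[< right_only p >]) (sigma p).

Lemma forget_subst_lhs s : in_rule r s -> atomic s ->
  map_mset (forget true) (subst_mset sigma (lhs s)) =
  subst_mset forget_subst (lhs s).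
Proof.
move=> rs [ats _]; apply: map_forget_subst => // p ps.
rewrite /forget_subst; by case: asboolP => // /(_ s rs).
Qed.

Lemma forget_subst_premise s : premises r s ->
  derivable R S (forget_sequent (subst_sequent sigma s)) ->
  derivable R S (subst_sequent forget_subst s).
Proof.
move=> rs; have ats := (proj1 (proj1 cut_r)) s rs.
rewrite /forget_sequent /subst_sequent /= forget_subst_lhs //; last by left.
have ->: map_mset (forget false) (subst_mset sigma (rhs s)) =
         map_mset (fun f => forget false (subst sigma f)) (rhs s).
  by rewrite /subst_mset map_mset_seq -map_comp.
rewrite -[map_mset _ _]msetD0 -[subst_mset forget_subst (rhs s)]msetD0.
apply: (derivable_map_msetr (F' := subst forget_subst)) => f fs.
have [p ->] := (proj2 ats) f fs; rewrite /= /forget_subst.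
case: asboolP => _; first exact: entails_refl.
(* This atom sits on the right but is assigned the weakened formula; the strengthened one entails it
   through [sigma p]. *)
exact: entails_trans (forget_entails R S _).1 (forget_entails R S _).2.
Qed.

(** An equality holds here: an atom on the right of the conclusion is no cut formula, hence a side
    formula confined to right-hand sides. *)
Lemma forget_subst_conclusion :
  forget_sequent (subst_sequent sigma (conclusion r)) =
  subst_sequent forget_subst (conclusion r).
Proof.
have atc := proj2 (proj1 cut_r).
rewrite /forget_sequent /subst_sequent /= forget_subst_lhs //; last by right.
congr Sequent; apply: map_forget_subst => [|p pc]; first exact: (proj2 atc).
rewrite /forget_subst; case: asboolP => // nro; exfalso.
have occ_c : occurs p (conclusion r) by right.
have := (proj2 cut_r) p; case.
- by exists (conclusion r) => //; right.
- by case=> _ /(_ occ_c).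
- by case=> _ [/(_ (conclusion r) (or_intror erefl))/(_ pc)|].
Qed.

End GeneralizedCut.

(** Each rule of GB is mapped to an instance of itself; in the negation rules the change of side
    matches the flip of polarity. *)
Lemma derivable_forget (R : set (rule A)) (S : set (sequent A)) t :
  (forall r, R r -> generalized_cut r) ->
  (forall s, S s -> S (forget_sequent s)) ->
  derivable R S t -> derivable R S (forget_sequent t).
Proof.
move=> hR hS; elim=> {t}; rewrite /forget_sequent /=.
- by move=> s /hS; exact: d_hyp.
- move=> r sigma Rr _ IH; rewrite -/(forget_sequent (subst_sequent _ _)).
  rewrite forget_subst_conclusion; last exact: hR.
  by apply: d_rule => // s rs; apply: forget_subst_premise; [exact: hR| |exact: IH].
- by move=> G D f g _ IHf _ IHg; rewrite !map_msetD1 in IHf IHg *; exact: d_andIr.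
- by move=> G D f g _; rewrite ?map_msetD1; exact: d_andIl.
- by move=> G D f g _ IHf _ IHg; rewrite !map_msetD1 in IHf IHg *; exact: d_orIl.
- by move=> G D f g _; rewrite ?map_msetD1; exact: d_orIr.
- by move=> G D f _; rewrite ?map_msetD1; exact: d_negIr.
- by move=> G D f _; rewrite ?map_msetD1; exact: d_negIl.
- by rewrite map_mset0 map_mset1; exact: d_topI.
- by rewrite map_mset0 map_mset1; exact: d_botI.
- by move=> G D f g _; rewrite ?map_msetD1; exact: d_andEr1.
- by move=> G D f g _; rewrite ?map_msetD1; exact: d_andEr2.
- by move=> G D f g _; rewrite ?map_msetD1; exact: d_andEl.
- by move=> G D f g _; rewrite ?map_msetD1; exact: d_orEl1.
- by move=> G D f g _; rewrite ?map_msetD1; exact: d_orEl2.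
- by move=> G D f g _; rewrite ?map_msetD1; exact: d_orEr.
- by move=> G D f _; rewrite ?map_msetD1; exact: d_negEr.
- by move=> G D f _; rewrite ?map_msetD1; exact: d_negEl.
- by move=> G D _; rewrite ?map_msetD1; exact: d_topE.
- by move=> G D _; rewrite ?map_msetD1; exact: d_botE.
- by move=> G D f _; rewrite ?map_msetD1; exact: d_weakl.
- by move=> G D f _; rewrite ?map_msetD1; exact: d_weakr.
- by move=> G D f _; rewrite ?map_msetD1; exact: d_contrl.
- by move=> G D f _; rewrite ?map_msetD1; exact: d_contrr.
Qed.

End Forget.

Theorem theorem5p11 (A : choiceType) (R : set (rule A))
    (hR : forall r : rule A, R r -> generalized_cut r) :
  has_interpolation (GB_with R) (GB_with R) (@GB A).
Proof.
move=> s t st; pose keep p := `[< occurs p s >].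
have keepP p : occurs p s -> keep p by move/asboolP.
exists (forget_sequent keep t); split.
(* The only hypothesis is [s], which is fixed since all its atoms are kept. *)
- by apply: derivable_forget => // _ ->; exact: forget_sequent_id.
- exact/(derivable_of_forget (keep := keep))/d_hyp.
- by move=> p /occurs_forget_sequent[/asboolP].
Qed.
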